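(* Let $\{f(\cdot;\theta)\}_{\theta\in\Theta}$ be a one-parameter statistical model satisfying the standing assumptions in the context, and let $m\ge1$. Let $T(X)$, $X\sim P_\theta$, be an unbiased estimator of $\theta$, $Z_0:=T(X)-\theta$, and $\widetilde Z_0:=Z_0s_\theta\in L^2(\mu)$. For $k\ge 1$ put $\mathcal T_k:=\operatorname{span}\{\eta_1,\dots,\eta_k\}\subset L^2(\mu)$ and $\mathcal B^{(k)}_{\mathrm{jet}}:=\|\operatorname{Proj}_{\mathcal T_k}\widetilde Z_0\|^2$. Let $G$ be the $m\times m$ matrix $G_{ij}=\langle\eta_i,\eta_j\rangle$, let $v$ be the row vector $v_j=\langle\eta_{m+1},\eta_j\rangle$, $1\le j\le m$, let $\Gamma^{\mathrm{proj}}:=vG^{-1}$, and define $$\mathrm{II}_m:=\eta_{m+1}-\sum_{k=1}^m\Gamma^{\mathrm{proj}}_k\,\eta_k,\qquad \mathcal N_m:=\operatorname{span}\{\mathrm{II}_m\}\subset\mathcal T_m^\perp .$$ Then $$\operatorname{Var}_\theta[T]\ \ge\ \mathcal C^{(m)}:=\mathcal B^{(m)}_{\mathrm{jet}}+\|\operatorname{Proj}_{\mathcal N_m}(\widetilde Z_0)\|^2,\qquad\text{and}\qquad \mathcal C^{(m)}=\mathcal B^{(m+1)}_{\mathrm{jet}} .$$ Equality holds in the inequality if and only if $R_m:=\widetilde Z_0-\operatorname{Proj}_{\mathcal T_m}\widetilde Z_0\in\mathcal N_m$.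
   Context: Setting. $\{P_\theta:\theta\in\Theta\subset\mathbb R\}$ is a smooth parametric family of probability measures on a measurable space, each having a strictly positive density $f(\cdot;\theta)$ with respect to a fixed base measure $\mu$. $L^2(\mu)$ is the real Hilbert space with $\langle u,v\rangle=\int uv\,d\mu$ and norm $\|\cdot\|$; $\operatorname{Proj}_V$ is orthogonal projection onto a subspace $V$. $\operatorname{Var}_\theta$ denotes variance under $P_\theta$. Write $s_\theta:=\sqrt{f(\cdot;\theta)}\in L^2(\mu)$ (so $\|s_\theta\|=1$) and $\eta_k:=\eta_k(\theta):=\partial_\theta^k s_\theta$ for $k\ge1$. The parameter value $\theta$ is fixed and all objects are evaluated at it. Standing assumptions. The derivatives $\eta_k(\theta)$, $k\ge1$, exist in the Fréchet sense in $L^2(\mu)$ and are linearly independent (so $G$ is invertible). Differentiation under the integral sign is permitted: for a statistic $T$ with $\mathbb E_\theta[T]$ finite, $\frac{\partial}{\partial\theta}\int T(x)f(x;\theta)\,d\mu=\int T(x)\frac{\partial f(x;\theta)}{\partial\theta}\,d\mu$ whenever the right-hand side is finite. The estimator $T$ has finite variance under $P_\theta$, so that $\widetilde Z_0\in L^2(\mu)$. *)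

(* Defs.v *)
From HB Require Import structures.
From mathcomp Require Import all_boot all_order all_algebra.
From mathcomp Require Import all_classical all_reals all_analysis.
From mathcomp Require Import measurable_realfun.

Set Implicit Arguments.
Unset Strict Implicit.
Unset Printing Implicit Defensive.

Import Order.TTheory GRing.Theory Num.Theory.
Import numFieldNormedType.Exports.

Local Open Scope classical_set_scope.
Local Open Scope ring_scope.
Local Open Scope quotient_scope.

Section L2.
Context {d : measure_display} {X : measurableType d} {R : realType}.
Variable mu : {measure set X -> \bar R}.

Local Notation fun2 := (LfunType mu (lee1n 2)).

Definition ae_null : {pred fun2} :=
  fun u => `[< (u : X -> R) = cst 0 %[ae mu] >].

Lemma ae_nullP (u : fun2) :
  reflect ((u : X -> R) = cst 0 %[ae mu]) (u \in ae_null).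
Proof. exact: asboolP. Qed.

Lemma ae_null_zmod_closed : zmod_closed ae_null.
Proof.
split=> [|u v /ae_nullP u0 /ae_nullP v0]; apply/ae_nullP.
  exact: ae_eq_refl.
apply: filterS2 u0 v0 => x ux vx xT.
by rewrite -[LHS]/(u x - v x) (ux xT) (vx xT) subr0.
Qed.

HB.instance Definition _ :=
  GRing.isZmodClosed.Build fun2 ae_null ae_null_zmod_closed.

(* The library's [LspaceType mu (lee1n 2)] carries neither a vector space
   structure nor a norm; L^2(mu) is therefore obtained as the quotient of the
   vector space of square-integrable functions by the a.e. null ones. *)
Definition L2 : Type := Quotient.quot ae_null.
HB.instance Definition _ := GRing.Zmodule.on L2.
HB.instance Definition _ := ZmodQuotient.on L2.

Lemma L2_eqP (u v : fun2) :
  \pi_L2 u = \pi_L2 v <-> (u : X -> R) = v %[ae mu].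
Proof.
have -> : (\pi_L2 u = \pi_L2 v) <-> (u - v \in ae_null).
  rewrite (Quotient.idealrBE ae_null u v).
  by split => [/eqP //|/eqP].
split=> [/ae_nullP h|h]; last apply/ae_nullP.
  by apply: filterS h => x hx xT; apply/eqP; rewrite -subr_eq0; apply/eqP/hx.
apply: filterS h => x hx xT.
by rewrite -[LHS]/(u x - v x) (hx xT) subrr.
Qed.

Lemma repr_pi_ae (u : fun2) : (repr (\pi_L2 u) : X -> R) = u %[ae mu].
Proof. by apply/L2_eqP; rewrite reprK. Qed.

Definition scaleL2 (a : R) (u : L2) : L2 := \pi_L2 (a *: repr u).

Lemma pi_scaleL2 a (u : fun2) : scaleL2 a (\pi_L2 u) = \pi_L2 (a *: u).
Proof.
apply/L2_eqP; have := repr_pi_ae u.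
apply: filterS => x hx xT.
by rewrite -[LHS]/(a * repr (\pi_L2 u) x) (hx xT).
Qed.

Lemma pi_addL2 (u v : fun2) : \pi_L2 u + \pi_L2 v = \pi_L2 (u + v) :> L2.
Proof. by rewrite !piE. Qed.

Lemma pi0L2 : \pi_L2 0 = 0 :> L2.
Proof. by rewrite !piE. Qed.

Lemma scaleL2A a b u : scaleL2 a (scaleL2 b u) = scaleL2 (a * b) u.
Proof. by elim/quotW: u => u; rewrite (pi_scaleL2 b) !pi_scaleL2 scalerA. Qed.

Lemma scale1L2 : left_id 1 scaleL2.
Proof. by move=> u; elim/quotW: u => u; rewrite pi_scaleL2 scale1r. Qed.

Lemma scaleL2Dr : right_distributive scaleL2 +%R.
Proof.
by move=> a u v; elim/quotW: u => u; elim/quotW: v => v;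
  rewrite pi_addL2 !pi_scaleL2 pi_addL2 scalerDr.
Qed.

Lemma scaleL2Dl u : {morph scaleL2^~ u : a b / a + b}.
Proof.
by move=> a b; elim/quotW: u => u; rewrite !pi_scaleL2 pi_addL2 scalerDl.
Qed.

HB.instance Definition _ := GRing.Zmodule_isLmodule.Build R L2
  scaleL2A scale1L2 scaleL2Dr scaleL2Dl.

Lemma pi_ZL2 a (u : fun2) : a *: (\pi_L2 u : L2) = \pi_L2 (a *: u).
Proof. exact: pi_scaleL2. Qed.

Definition normL2 (u : L2) : R := fine ('N[mu]_2%:E[EFin \o repr u])%E.

Lemma ae_eq_Lnorm2 (u v : fun2) : (u : X -> R) = v %[ae mu] ->
  ('N[mu]_2%:E[EFin \o u] = 'N[mu]_2%:E[EFin \o v])%E.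
Proof.
move=> uv; have m2 (w : fun2) : measurable_fun setT (fun x => (`|w x| `^ 2)%:E).
  apply/measurable_EFinP.
  apply: (@measurableT_comp _ _ _ _ _ _ (fun r : R => r `^ 2)) => //.
  exact: measurableT_comp.
rewrite unlock; congr (_ `^ _)%E; apply: ae_eq_integral => //; try exact: m2.
by apply: filterS uv => x hx xT /=; rewrite (hx xT).
Qed.

Lemma pi_normL2 (u : fun2) : normL2 (\pi_L2 u) = fine ('N[mu]_2%:E[EFin \o u])%E.
Proof. by rewrite /normL2 (ae_eq_Lnorm2 (repr_pi_ae u)). Qed.

Lemma ler_normL2D u v : normL2 (u + v) <= normL2 u + normL2 v.
Proof.
by elim/quotW: u => u; elim/quotW: v => v;
  rewrite pi_addL2 !pi_normL2 ler_LnormD.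
Qed.

Lemma normL2Z a u : normL2 (a *: u) = `|a| * normL2 u.
Proof.
elim/quotW: u => u; rewrite pi_ZL2 !pi_normL2.
by apply: EFin_inj; rewrite EFinM !finite_norm_fine LnormZ.
Qed.

Lemma normL2_eq0 u : normL2 u = 0 -> u = 0.
Proof.
elim/quotW: u => u; rewrite pi_normL2 => /fine_Lnormr_eq0 u0.
by rewrite -pi0L2; apply/L2_eqP.
Qed.

HB.instance Definition _ := Lmodule_isNormed.Build R L2
  ler_normL2D normL2Z normL2_eq0.

Definition dotL2 (u v : L2) : R := \int[mu]_x (repr u x * repr v x).

Lemma pi_dotL2 (u v : fun2) :
  dotL2 (\pi_L2 u) (\pi_L2 v) = \int[mu]_x (u x * v x).
Proof.
congr fine; apply: ae_eq_integral => //.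
- by apply/measurable_EFinP; exact: measurable_funM.
- by apply/measurable_EFinP; exact: measurable_funM.
- by apply: filterS2 (repr_pi_ae u) (repr_pi_ae v) => x /= hu hv xT;
    rewrite hu// hv.
Qed.

Lemma normL2_sqr (u : L2) : `|u| ^+ 2 = dotL2 u u.
Proof.
elim/quotW: u => u; rewrite pi_dotL2 [`|_|]pi_normL2.
rewrite -powR_mulrn ?fine_ge0 ?Lnorm_ge0//.
rewrite -[LHS]/(fine (_%:E)) -poweR_EFin finite_norm_fine poweR_Lnorm//.
congr fine; apply: eq_integral => x _ /=.
by rewrite powR_mulrn// real_normK ?num_real// expr2.
Qed.

(* The class of [g]; the value 0 is used when [g] is not square-integrable. *)
Definition toL2 (g : X -> R) : L2 :=
  match pselect (g \in Lfun mu 2%:E) with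
  | left g2 => \pi_L2 (Lfun_Sub (lee1n 2) g2)
  | right _ => 0
  end.

End L2.

Section inner_product_geometry.
Context {d : measure_display} {X : measurableType d} {R : realType}.
Context {mu : {measure set X -> \bar R}}.
Implicit Types (V : set (L2 mu)) (u v p : L2 mu).

Definition orthL2 V : set (L2 mu) := [set u | forall w, V w -> dotL2 u w = 0].

(* The default value 0 of [xget] is never taken for a finite-dimensional [V],
   on which the orthogonal projection exists and is unique. *)
Definition projL2 V u : L2 mu := xget 0 [set p | V p /\ orthL2 V (u - p)].

Definition spanL2 k (e : 'I_k -> L2 mu) : set (L2 mu) :=
  [set u | exists c : 'I_k -> R, u = \sum_i c i *: e i].

Definition lin_indepL2 (e : nat -> L2 mu) : Prop :=
  forall n (c : 'I_n -> R), \sum_i c i *: e i = 0 -> forall i, c i = 0.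

End inner_product_geometry.

Section statistical_model.
Context {d : measure_display} {X : measurableType d} {R : realType}.
Variable mu : {measure set X -> \bar R}.
Variable Theta : set R.
Variable P : R -> probability X R.
Variable f : R -> X -> R.
Implicit Types (theta t : R) (k m : nat).

(* [P] and [f] are total in the parameter, but constrained on [Theta] only. *)
Definition positive_density_family : Prop :=
  forall t, Theta t ->
    [/\ measurable_fun setT (f t), (forall x, 0 < f t x) &
        forall A, measurable A -> P t A = (\int[mu]_(x in A) (f t x)%:E)%E].

Definition root_density t : L2 mu := toL2 mu (fun x => Num.sqrt (f t x)).

Definition root_jet theta k : L2 mu := derive1n k root_density theta.

Definition frechet_smooth theta : Prop :=
  forall k, \forall t \near theta, differentiable (derive1n k root_density) t.

(* A derivative [derive1] carries no existence claim, hence the first clause.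
   The statistics [S] are those with a finite expectation throughout the
   family, so that the left-hand side is a function of the parameter. *)
Definition diff_under_integral theta : Prop :=
  (forall x, derivable (fun t => f t x) theta 1) /\
  forall S : {mfun X >-> R},
    (forall t, Theta t -> 'E_(P t)[S] \is a fin_num)%E ->
    mu.-integrable setT (fun x => (S x * derive1 (fun t => f t x) theta)%:E) ->
    is_derive theta 1 (fun t => \int[mu]_x (S x * f t x))
      (\int[mu]_x (S x * derive1 (fun t => f t x) theta)).

Definition unbiased (T : X -> R) : Prop :=
  forall t, Theta t -> ('E_(P t)[T] = t%:E)%E.

Definition weighted_error (T : X -> R) theta : L2 mu :=
  toL2 mu (fun x => (T x - theta) * Num.sqrt (f theta x)).

(* Indices in 'I_k start at 0: from here on, index i stands for the derivative
   of order i + 1. *)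
Definition jet_space theta k : set (L2 mu) :=
  spanL2 (fun i : 'I_k => root_jet theta i.+1).

Definition jet_bound (T : X -> R) theta k : R :=
  `|projL2 (jet_space theta k) (weighted_error T theta)| ^+ 2.

Definition gram theta m : 'M[R]_m :=
  \matrix_(i < m, j < m) dotL2 (root_jet theta i.+1) (root_jet theta j.+1).

Definition Gamma_proj theta m : 'rV[R]_m :=
  (\row_(j < m) dotL2 (root_jet theta m.+1) (root_jet theta j.+1))
    *m invmx (gram theta m).

Definition second_form theta m : L2 mu :=
  root_jet theta m.+1 -
  \sum_(k < m) Gamma_proj theta m 0 k *: root_jet theta k.+1.

Definition normal_line theta m : set (L2 mu) :=
  spanL2 (fun _ : 'I_1 => second_form theta m).

Definition curvature_bound (T : X -> R) theta m : R :=
  jet_bound T theta m +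
  `|projL2 (normal_line theta m) (weighted_error T theta)| ^+ 2.

Definition jet_residual (T : X -> R) theta m : L2 mu :=
  weighted_error T theta -
  projL2 (jet_space theta m) (weighted_error T theta).

End statistical_model.

Arguments jet_space {d X R} mu f theta k _.
Arguments normal_line {d X R} mu f theta m _.

(* Main.v *)
(** II_m is the Gram-Schmidt residual of the (m+1)-st derivative against the
    first m, so T_(m+1) is the orthogonal sum of T_m and N_m. By Pythagoras the
    projections onto T_m and N_m add up to the one onto T_(m+1), whence
    C^(m) = B^(m+1). Since the density of P_theta is positive and T has mean
    theta, the variance of T is the squared L^2(mu)-norm of the weighted error;
    it therefore exceeds B^(m+1) by the squared norm of R_m minus its
    projection on N_m. *)
Require Import Defs.
From HB Require Import structures.
From mathcomp Require Import all_boot all_order all_algebra.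
From mathcomp Require Import all_classical all_reals all_analysis.
From mathcomp Require Import measurable_realfun.

Set Implicit Arguments.
Unset Strict Implicit.
Unset Printing Implicit Defensive.

Import Order.TTheory GRing.Theory Num.Theory.
Import numFieldNormedType.Exports.

Local Open Scope classical_set_scope.
Local Open Scope ring_scope.

(** * Change of measure by a density *)

Section density.
Local Open Scope ereal_scope.
Import HBNNSimple.
Context d (X : measurableType d) (R : realType).
Variables (mu nu : {measure set X -> \bar R}) (g : X -> R).
Hypothesis mg : measurable_fun setT g.
Hypothesis g_ge0 : forall x, (0 <= g x)%R.
Hypothesis nuE : forall A, measurable A -> nu A = \int[mu]_(x in A) (g x)%:E.

Let mgE : measurable_fun setT (EFin \o g).
Proof. exact/measurable_EFinP. Qed.

(** Monotone convergence on both sides reduces [h] to its simple approximations, and additivity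
    reduces these to indicators of level sets, where the claim is [nuE]. *)
Lemma ge0_integral_density (h : X -> \bar R) :
  measurable_fun setT h -> (forall x, 0 <= h x) ->
  \int[nu]_x h x = \int[mu]_x (h x * (g x)%:E).
Proof.
move=> mh h0; pose s := nnsfun_approx measurableT mh.
have sh x : (EFin \o s n) x @[n --> \oo] --> h x by exact: cvg_nnsfun_approx.
transitivity (limn (fun n => \int[nu]_x (EFin \o s n) x)).
  under eq_integral => x _ do rewrite -(cvg_lim _ (sh x))//.
  apply: monotone_convergence => //.
  - by move=> n; exact/measurable_EFinP.
  - by move=> n x _ /=; rewrite lee_fin.
  - by move=> x _ a b ab; rewrite lee_fin; exact/lefP/nd_nnsfun_approx.
transitivity (limn (fun n => \int[mu]_x ((EFin \o s n) x * (g x)%:E))); last first.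
  have shg x : (EFin \o s n) x * (g x)%:E @[n --> \oo] --> h x * (g x)%:E.
    by apply: cvgeZr => //; exact: sh.
  under [RHS]eq_integral => x _ do rewrite -(cvg_lim _ (shg x))//.
  apply/esym/monotone_convergence => //.
  - by move=> n; apply: emeasurable_funM => //; exact/measurable_EFinP.
  - by move=> n x _ /=; rewrite mule_ge0 ?lee_fin.
  - move=> x _ a b ab /=; rewrite lee_wpmul2r ?lee_fin//.
    exact/lefP/nd_nnsfun_approx.
congr (limn _); apply/funext => n.
(* This covers [r < 0] too: [s n] is nonnegative, so that level set is empty. *)
have indic_ge0 r x : 0 <= (r * \1_(s n @^-1` [set r]) x)%:E.
  by rewrite EFinM nnfun_muleindic_ge0.
have indich r : measurable_fun setT (fun x => (r * \1_(s n @^-1` [set r]) x)%:E).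
  by apply/measurable_EFinP; exact: measurable_funM.
transitivity (\sum_(r \in range (s n))
    \int[nu]_x (r * \1_(s n @^-1` [set r]) x)%:E).
  rewrite -ge0_integral_fsum//.
  by apply: eq_integral => x _; rewrite /= fimfunE -fsumEFin.
transitivity (\sum_(r \in range (s n))
    \int[mu]_x ((r * \1_(s n @^-1` [set r]) x)%:E * (g x)%:E)); last first.
  rewrite -ge0_integral_fsum//; last 2 first.
  - by move=> r; apply: emeasurable_funM.
  - by move=> r x _; rewrite mule_ge0// lee_fin.
  apply: eq_integral => x _; rewrite /= [in RHS]fimfunE -fsumEFin//.
  by rewrite ge0_mule_fsuml// => r.
(* Writing [r] as a value [s n x0] makes it nonnegative, so that it can be pulled out of both
   integrals. *)
apply: eq_fsbigr => r /[!inE] -[x0 _ <-].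
have mA : measurable (s n @^-1` [set s n x0]) by exact: measurable_sfunP.
under eq_integral do rewrite EFinM.
rewrite ge0_integralZl//; last 2 first.
- by apply/measurable_EFinP.
- by rewrite lee_fin.
under [RHS]eq_integral do rewrite EFinM -muleA.
rewrite ge0_integralZl//; last 3 first.
- by apply: emeasurable_funM => //; exact/measurable_EFinP.
- by move=> x _; rewrite mule_ge0 ?lee_fin.
- by rewrite lee_fin.
congr (_ * _); rewrite integral_indic// setIT nuE// integral_mkcond.
by apply: eq_integral => x _; rewrite epatch_indic muleC.
Qed.

End density.

(** * Bilinearity of the inner product and Pythagoras *)

Section inner_product.
Context d (X : measurableType d) (R : realType).
Variable mu : {measure set X -> \bar R}.
Implicit Types (u v w : L2 mu) (a : R).

Lemma integrable_dotL2 (u v : LfunType mu (lee1n 2)) :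
  mu.-integrable setT (fun x => (u x * v x)%:E).
Proof. by apply/Lfun1_integrable/Lfun2_mul_Lfun1; exact: LfunP. Qed.

Lemma dotL2C u v : dotL2 u v = dotL2 v u.
Proof. by apply: eq_Rintegral => x _; rewrite mulrC. Qed.

Lemma dotL2Dl u v w : dotL2 (u + v) w = dotL2 u w + dotL2 v w.
Proof.
elim/quotW: u => u; elim/quotW: v => v; elim/quotW: w => w.
rewrite pi_addL2 !pi_dotL2 -RintegralD//; try exact: integrable_dotL2.
by apply: eq_Rintegral => x _; rewrite -mulrDl.
Qed.

Lemma dotL2Zl a u w : dotL2 (a *: u) w = a * dotL2 u w.
Proof.
elim/quotW: u => u; elim/quotW: w => w.
rewrite pi_ZL2 !pi_dotL2 -RintegralZl//; last exact: integrable_dotL2.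
by apply: eq_Rintegral => x _; rewrite mulrA.
Qed.

Lemma dotL20l w : dotL2 0 w = 0.
Proof. by rewrite -(scale0r 0) dotL2Zl mul0r. Qed.

Lemma dotL2Bl u v w : dotL2 (u - v) w = dotL2 u w - dotL2 v w.
Proof. by rewrite dotL2Dl -scaleN1r dotL2Zl mulN1r. Qed.

Lemma dotL2_suml k (c : 'I_k -> R) (e : 'I_k -> L2 mu) w :
  dotL2 (\sum_i c i *: e i) w = \sum_i c i * dotL2 (e i) w.
Proof.
apply: (big_ind2 (fun u a => dotL2 u w = a)) => [|u a v b <- <-|i _].
- exact: dotL20l.
- exact: dotL2Dl.
- exact: dotL2Zl.
Qed.

Lemma normL2D_orth u v : dotL2 u v = 0 -> `|u + v| ^+ 2 = `|u| ^+ 2 + `|v| ^+ 2.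
Proof.
move=> uv; rewrite !normL2_sqr dotL2Dl ![dotL2 _ (u + v)]dotL2C !dotL2Dl.
by rewrite (dotL2C v u) uv addr0 add0r.
Qed.

End inner_product.

(** * Orthogonal projection onto a finite span through the Gram matrix *)

Section projection.
Context d (X : measurableType d) (R : realType).
Context (mu : {measure set X -> \bar R}) (k : nat) (e : 'I_k -> L2 mu).
Implicit Types u v w p : L2 mu.

Lemma spanL2_linear a u v :
  spanL2 e u -> spanL2 e v -> spanL2 e (a *: u + v).
Proof.
move=> [b ->] [c ->]; exists (fun i => a * b i + c i).
rewrite scaler_sumr -big_split/=; apply: eq_bigr => i _.
by rewrite scalerDl scalerA.
Qed.

Lemma mem_spanL2 i : spanL2 e (e i).
Proof.
exists (fun j => (j == i)%:R).
rewrite (bigD1 i)//= eqxx scale1r big1 ?addr0// => j /negbTE ->.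
by rewrite scale0r.
Qed.

Lemma orthL2_spanP u :
  orthL2 (spanL2 e) u <-> forall i, dotL2 u (e i) = 0.
Proof.
split=> [ue i|ue _ [c ->]]; first exact/ue/mem_spanL2.
by rewrite dotL2C dotL2_suml big1// => i _; rewrite dotL2C ue mulr0.
Qed.

(** The difference of two candidates lies in the span and is orthogonal to it, hence to itself, so
    it vanishes. *)
Lemma projL2_eq u p :
  spanL2 e p -> orthL2 (spanL2 e) (u - p) -> projL2 (spanL2 e) u = p.
Proof.
move=> ep up; apply: xget_unique => // q [eq uq].
apply/eqP; rewrite -subr_eq0 -normr_eq0 -sqrf_eq0 normL2_sqr; apply/eqP.
have eqp : spanL2 e (q - p).
  by rewrite addrC -scaleN1r; exact: spanL2_linear.
(* Only the left factor of the inner product is split, into two residuals orthogonal to the span;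
   the right factor stays a member of the span. *)
have {1}-> : q - p = (u - p) - (u - q) by rewrite opprB [RHS]addrC [RHS]addrA addrNK.
by rewrite dotL2Bl up// uq// subrr.
Qed.

Hypothesis free_e :
  forall c : 'I_k -> R, \sum_i c i *: e i = 0 -> forall i, c i = 0.

Let G := \matrix_(i < k, j < k) dotL2 (e i) (e j).

Lemma dotL2_sum_gram (c : 'rV[R]_k) j :
  dotL2 (\sum_i c 0 i *: e i) (e j) = (c *m G) 0 j.
Proof.
by rewrite dotL2_suml mxE; apply: eq_bigr => i _; rewrite !mxE.
Qed.

(* A row vector in the kernel of G makes [\sum_i c_i e_i] orthogonal to itself. *)
Lemma gram_unitmx : G \in unitmx.
Proof.
rewrite -row_free_unit -kermx_eq0; apply/rowV0P => c /sub_kermxP cG0.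
apply/rowP => i; rewrite [RHS]mxE; apply: (free_e (c := fun i => c 0 i)).
apply/eqP; rewrite -normr_eq0 -sqrf_eq0 normL2_sqr; apply/eqP.
have ort : orthL2 (spanL2 e) (\sum_i c 0 i *: e i).
  by apply/orthL2_spanP => j; rewrite dotL2_sum_gram cG0 mxE.
by apply: ort; exists (fun i => c 0 i).
Qed.

(** The solution [c] of the normal equations, in which [c *m G] is the row of inner products of [u]
    with the [e j]. *)
Definition proj_coefL2 u : 'rV[R]_k := (\row_j dotL2 u (e j)) *m invmx G.

Lemma orth_proj_coefL2 u :
  orthL2 (spanL2 e) (u - \sum_i proj_coefL2 u 0 i *: e i).
Proof.
apply/orthL2_spanP => j.
by rewrite dotL2Bl dotL2_sum_gram mulmxKV ?gram_unitmx// mxE subrr.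
Qed.

Lemma projL2E u : projL2 (spanL2 e) u = \sum_i proj_coefL2 u 0 i *: e i.
Proof.
apply: projL2_eq; last exact: orth_proj_coefL2.
by exists (fun i => proj_coefL2 u 0 i).
Qed.

Lemma projL2_in u : spanL2 e (projL2 (spanL2 e) u).
Proof. by rewrite projL2E; exists (fun i => proj_coefL2 u 0 i). Qed.

Lemma projL2_orth u : orthL2 (spanL2 e) (u - projL2 (spanL2 e) u).
Proof. by rewrite projL2E; exact: orth_proj_coefL2. Qed.

End projection.

(** Coefficient families on ['I_m.+1] are defined below by cases on [unlift ord_max], which is
    [None] at the last index only; this evaluates them at the others. *)
Lemma unlift_max_widen m (i : 'I_m) :
  unlift ord_max (widen_ord (leqnSn m) i) = Some i.
Proof.
have <- : lift ord_max i = widen_ord (leqnSn m) i by exact/val_inj/lift_max.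
exact: liftK.
Qed.

(** * Adjoining one vector to a free family *)

Section gram_schmidt.
Context d (X : measurableType d) (R : realType).
Context (mu : {measure set X -> \bar R}) (e : nat -> L2 mu) (m : nat).
Hypothesis free_e : lin_indepL2 e.
Implicit Types u v w p : L2 mu.

Let E k := spanL2 (fun i : 'I_k => e i).
Let em := fun i : 'I_m => e i.
(** When [e k] is the root derivative of order [k.+1], the terms [g], [n] and [N] unfold to
    [Gamma_proj], [second_form] and [normal_line], and [E k] to [jet_space]. *)
Let g := proj_coefL2 em (e m).
Let n := e m - \sum_i g 0 i *: em i.
Let N := spanL2 (fun _ : 'I_1 => n).

Lemma gram_schmidt_orth : orthL2 (E m) n.
Proof. by apply: orth_proj_coefL2; exact: free_e. Qed.

Lemma gram_schmidt_line_orth : N `<=` orthL2 (E m).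
Proof.
by move=> _ [c ->] w Ew; rewrite big_ord1 dotL2Zl gram_schmidt_orth ?mulr0.
Qed.

Let c (i : 'I_m.+1) := oapp (fun j => - g 0 j) 1 (unlift ord_max i).

Lemma gram_schmidt_sum : n = \sum_i c i *: e i.
Proof.
rewrite big_ord_recr/= {2}/c unlift_none/= scale1r addrC; congr (_ + _).
rewrite -sumrN; apply: eq_bigr => i _; rewrite /em -scaleNr; congr (_ *: _).
by rewrite /c unlift_max_widen.
Qed.

(** The coefficient of [e m] in [n] is 1, so [n = 0] would contradict freeness. Hence [N] is a true
    line and the projection results apply to it. *)
Lemma gram_schmidt_neq0 : n != 0.
Proof.
apply/negP; rewrite gram_schmidt_sum => /eqP /free_e /(_ ord_max).
by rewrite /c unlift_none/=; apply/eqP/oner_neq0.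
Qed.

Lemma free_gram_schmidt (b : 'I_1 -> R) :
  \sum_(i < 1) b i *: n = 0 -> forall i, b i = 0.
Proof.
rewrite big_ord1 => /eqP; rewrite scaler_eq0 (negbTE gram_schmidt_neq0) orbF.
by move=> /eqP b0 i; rewrite ord1.
Qed.

Lemma sub_span_recr : E m `<=` E m.+1.
Proof.
move=> _ [a ->]; exists (fun i => oapp a 0 (unlift ord_max i)).
rewrite big_ord_recr/= unlift_none/= scale0r addr0; apply: eq_bigr => i _.
by rewrite unlift_max_widen.
Qed.

Lemma gram_schmidt_line_sub : N `<=` E m.+1.
Proof.
move=> _ [a ->]; rewrite big_ord1 -[_ *: _]addr0; apply: spanL2_linear.
- by exists c; exact: gram_schmidt_sum.
- by exists (fun=> 0); rewrite big1// => i _; rewrite scale0r.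
Qed.

(** The new vector [e m] is the sum of [n] and a member of [E m]. *)
Lemma orthL2_span_recr u :
  orthL2 (E m) u -> orthL2 N u -> orthL2 (E m.+1) u.
Proof.
move=> uE uN; apply/orthL2_spanP => i; rewrite dotL2C.
have [im|] := ltnP i m.
  by rewrite dotL2C; apply: uE; exact: (mem_spanL2 _ (Ordinal im)).
move=> mi; have -> : i = m :> nat by apply/eqP; rewrite eqn_leq mi -ltnS andbT.
rewrite -[e m](subrK (\sum_i g 0 i *: em i)) dotL2Dl -/n.
rewrite dotL2C uN ?add0r; last exact: (mem_spanL2 _ ord0).
by rewrite dotL2C uE//; exists (fun i => g 0 i).
Qed.

(** By uniqueness of the projection: the residual of the sum is orthogonal to [E m] and to [N],
    since each projection is orthogonal to the other space. *)
Lemma projL2_span_recr u :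
  projL2 (E m.+1) u = projL2 (E m) u + projL2 N u.
Proof.
have pE : E m (projL2 (E m) u) by apply: projL2_in; exact: free_e.
have pN : N (projL2 N u) by apply: projL2_in; exact: free_gram_schmidt.
apply: projL2_eq.
  rewrite -[X in X + _]scale1r; apply: spanL2_linear; first exact: sub_span_recr.
  exact: gram_schmidt_line_sub.
apply: orthL2_span_recr => w Ww; rewrite opprD.
  rewrite addrA dotL2Bl projL2_orth//; last exact: free_e.
  by rewrite (gram_schmidt_line_orth pN)// subrr.
rewrite addrCA addrC dotL2Bl projL2_orth//; last exact: free_gram_schmidt.
by rewrite dotL2C (gram_schmidt_line_orth Ww)// subrr.
Qed.

Lemma normL2_projL2_span_recr u :
  `|projL2 (E m.+1) u| ^+ 2 =
  `|projL2 (E m) u| ^+ 2 + `|projL2 N u| ^+ 2.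
Proof.
rewrite projL2_span_recr normL2D_orth// dotL2C gram_schmidt_line_orth//.
- by apply: projL2_in; exact: free_gram_schmidt.
- by apply: projL2_in; exact: free_e.
Qed.

Lemma normL2_projL2_residual k u :
  `|u| ^+ 2 = `|projL2 (E k) u| ^+ 2 + `|u - projL2 (E k) u| ^+ 2.
Proof.
rewrite -[in LHS](subrKC (projL2 (E k) u) u) [LHS]normL2D_orth//.
by rewrite dotL2C projL2_orth//; [exact: free_e|apply: projL2_in; exact: free_e].
Qed.

(** Equality of the norms kills the residual over [E m.+1], which is the residual over [E m] minus
    the projection of [u] on [N]. *)
Lemma normL2_projL2_span_recr_eq u :
  `|u| ^+ 2 = `|projL2 (E m.+1) u| ^+ 2 <-> N (u - projL2 (E m) u).
Proof.
rewrite (normL2_projL2_residual m.+1 u); split=> [|Nu].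
  move/eqP; rewrite addrC -subr_eq0 addrK sqrf_eq0 normr_eq0.
  rewrite projL2_span_recr opprD addrA subr_eq0 => /eqP ->.
  by apply: projL2_in; exact: free_gram_schmidt.
suff -> : u - projL2 (E m.+1) u = 0 by rewrite normr0 expr0n addr0.
(* A residual over [E m] that lies in [N] is itself the projection of [u] on [N]: what remains of
   [u] is its projection on [E m], orthogonal to [N]. *)
rewrite projL2_span_recr [projL2 N u](_ : _ = u - projL2 (E m) u).
  by rewrite subrKC subrr.
apply: projL2_eq => // w Nw; rewrite subKr dotL2C gram_schmidt_line_orth//.
by apply: projL2_in; exact: free_e.
Qed.

End gram_schmidt.

(** * The variance as a squared norm *)

Section weighted_error.
Context d (X : measurableType d) (R : realType).
Variables (mu : {measure set X -> \bar R}) (P : probability X R) (f : X -> R).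
Hypothesis mf : measurable_fun setT f.
Hypothesis f_gt0 : forall x, 0 < f x.
Hypothesis PE : forall A, measurable A -> P A = (\int[mu]_(x in A) (f x)%:E)%E.
Variables (T : {mfun X >-> R}) (t : R).
Hypothesis ET : ('E_P[T] = t%:E)%E.

Let z x := (T x - t) * Num.sqrt (f x).

Lemma variance_density : ('V_P[T] = \int[mu]_x (z x ^+ 2)%:E)%E.
Proof.
rewrite /variance unlock ET expectation_def/=.
rewrite (@ge0_integral_density _ _ _ mu P f)//.
- apply: eq_integral => x _.
  by rewrite -EFinM exprMn sqr_sqrtr ?ltW// expr2.
- by move=> x; exact: ltW.
- apply/measurable_EFinP.
  by apply: measurable_funM; apply: measurable_funB.
- by move=> x; rewrite lee_fin -expr2 sqr_ge0.
Qed.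

Lemma variance_normL2 : ('V_P[T] < +oo)%E ->
  ('V_P[T] = (`|toL2 mu z| ^+ 2)%:E)%E.
Proof.
move=> VT; have mz : measurable_fun setT z.
  apply: measurable_funM; first exact: measurable_funB.
  apply: (measurableT_comp (f := @Num.sqrt R)) => //.
  by apply: continuous_measurable_fun; exact: sqrt_continuous.
(* Finiteness of the variance passes through this identity to the 2-norm of [z], which makes [z]
   square-integrable. *)
have zE : ('N[mu]_2%:E[EFin \o z] `^ 2 = 'V_P[T])%E.
  rewrite poweR_Lnorm// variance_density; apply: eq_integral => x _ /=.
  by rewrite powR_mulrn// real_normK ?num_real.
have z2 : z \in Lfun mu 2%:E.
  rewrite inE; apply/andP; split; rewrite inE//=.
  apply: (@lty_poweRy _ _ 2) => //.
  by rewrite zE.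
(* Membership [z2] rules out the default class 0 of [toL2]. *)
rewrite /toL2; case: pselect => // z2'.
have VE : ('V_P[T] = \int[mu]_x (z x * z x)%:E)%E.
  by rewrite variance_density; apply: eq_integral => x _; rewrite expr2.
by rewrite normL2_sqr pi_dotL2 /Rintegral -VE fineK// ge0_fin_numE ?variance_ge0.
Qed.

End weighted_error.

Theorem theorem5 (d : measure_display) (X : measurableType d) (R : realType)
  (mu : {measure set X -> \bar R}) (Theta : set R)
  (P : R -> probability X R) (f : R -> X -> R) (theta : R)
  (T : {mfun X >-> R}) (m : nat)
  (theta_in : interior Theta theta)
  (densityP : positive_density_family mu Theta P f)
  (smooth : frechet_smooth mu f theta)
  (jet_free : lin_indepL2 (fun k => root_jet mu f theta k.+1))
  (interchange : diff_under_integral mu Theta P f theta)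
  (unbiasedT : unbiased Theta P T)
  (finite_varT : ('V_(P theta)[T] < +oo)%E)
  (m_ge1 : (1 <= m)%N) :
  [/\ normal_line mu f theta m `<=` orthL2 (jet_space mu f theta m),
      ((curvature_bound mu f T theta m)%:E <= 'V_(P theta)[T])%E,
      curvature_bound mu f T theta m = jet_bound mu f T theta m.+1 &
      ('V_(P theta)[T] = (curvature_bound mu f T theta m)%:E)%E <->
      normal_line mu f theta m (jet_residual mu f T theta m)].
Proof.
have [mf f_gt0 PE] := densityP _ (interior_subset theta_in).
have ET := unbiasedT _ (interior_subset theta_in).
have VE := variance_normL2 mf f_gt0 PE ET finite_varT.
set z := toL2 _ _ in VE.
have CB : curvature_bound mu f T theta m = jet_bound mu f T theta m.+1.
  exact/esym/(normL2_projL2_span_recr m jet_free).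
split=> //.
- exact: (gram_schmidt_line_orth jet_free).
(* The gap between the variance and the bound is the squared norm of the residual over the first
   [m.+1] derivatives. *)
- rewrite CB VE lee_fin (normL2_projL2_residual jet_free m.+1 z).
  by rewrite lerDl sqr_ge0.
- have [VN NV] := normL2_projL2_span_recr_eq m jet_free z.
  by rewrite CB VE; split=> [[/VN]|/NV ->].
Qed.
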